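(* Let $\alpha\in[0,1]$ and let $T$ be a mixed tree of order $n$ and size $m$, and set $k=\left\lceil \frac{n}{2n-m-1}\right\rceil$. Then $\rho_\alpha(T)\geq \rho_\alpha(P_k)$, where $P_k$ denotes the mixed path of order $k$ and size $2k-2$ (i.e. the undirected path on $k$ vertices). Moreover, the lower bound is attained when $T=P_n$.
   Context: A mixed graph $G$ on vertex set $[n]$ is a graph in which between two distinct vertices there is at most one of: a directed arc $\vec{ij}$, an undirected edge $ij$, or nothing. Its size is the number of arcs plus twice the number of undirected edges. Its adjacency matrix $A=(a_{ij})$ has $a_{ij}=1$ iff $\vec{ij}\in E(G)$ or $ij\in E(G)$, and $0$ otherwise. The out-degree of $i$ is $d^+_i=|\{j: \vec{ij}\in E(G)\text{ or } ij\in E(G)\}|$, $D^+=\mathrm{diag}(d^+_1,\dots,d^+_n)$, $A_\alpha(G)=\alpha D^++(1-\alpha)A$ for $\alpha\in[0,1]$, and $\rho_\alpha(G)$ is the largest real eigenvalue of $A_\alpha(G)$. A mixed tree is a mixed graph whose underlying undirected graph (forget arc directions) is a tree; a mixed path is one whose underlying graph is a path. *)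

(* Defs.v *)
From HB Require Import structures.
From mathcomp Require Import all_boot all_order all_algebra perm.
From mathcomp Require Import all_classical all_reals.

Set Implicit Arguments.
Unset Strict Implicit.
Unset Printing Implicit Defensive.

Import Order.TTheory GRing.Theory Num.Theory.

Local Open Scope ring_scope.

Record mixed_graph (n : nat) := MixedGraph {
  dir_arc : rel 'I_n;
  und_edge : rel 'I_n;
  dir_arc_irr : irreflexive dir_arc;
  und_edge_irr : irreflexive und_edge;
  und_edge_sym : symmetric und_edge;
  dir_arc_asym : forall i j, dir_arc i j -> ~~ dir_arc j i;
  arc_edge_excl : forall i j, dir_arc i j -> ~~ und_edge i j
}.

Section MixedGraph.
Variables (n : nat) (G : mixed_graph n).

Definition out_adj : rel 'I_n := [rel i j | dir_arc G i j || und_edge G i j].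

(* Each undirected edge is counted once, through its pair (i, j) with i < j. *)
Definition mixed_size : nat :=
  (#|[pred p : 'I_n * 'I_n | dir_arc G p.1 p.2]|
   + 2 * #|[pred p : 'I_n * 'I_n | (p.1 < p.2)%N && und_edge G p.1 p.2]|)%N.

Definition out_degree (i : 'I_n) : nat := #|[pred j | out_adj i j]|.

Definition underlying : rel 'I_n :=
  [rel i j | [|| dir_arc G i j, dir_arc G j i | und_edge G i j]].

(* A cycle is a duplicate-free cyclic sequence of at least three vertices:
   [ucycle] also accepts [:: i; j] for any two adjacent vertices. *)
Definition is_mixed_tree : Prop :=
  [/\ (0 < n)%N,
      forall i j, connect underlying i j
    & forall c : seq 'I_n, ucycle underlying c -> (size c < 3)%N].

End MixedGraph.

Definition mixed_iso (n : nat) (G H : mixed_graph n) : Prop :=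
  exists s : {perm 'I_n}, forall i j,
    dir_arc H (s i) (s j) = dir_arc G i j /\
    und_edge H (s i) (s j) = und_edge G i j.

Section UndirectedPath.
Variable k : nat.

Definition path_arc : rel 'I_k := [rel _ _ | false].
Definition path_edge : rel 'I_k :=
  [rel i j : 'I_k | (i.+1 == j :> nat) || (j.+1 == i :> nat)].

Fact path_arc_irr : irreflexive path_arc. Proof. by []. Qed.

Fact path_edge_irr : irreflexive path_edge.
Proof. by move=> i; rewrite /path_edge /= gtn_eqF. Qed.

Fact path_edge_sym : symmetric path_edge.
Proof. by move=> i j; apply: orbC. Qed.

Fact path_arc_asym i j : path_arc i j -> ~~ path_arc j i. Proof. by []. Qed.

Fact path_arc_edge_excl i j : path_arc i j -> ~~ path_edge i j.
Proof. by []. Qed.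

Definition undirected_path : mixed_graph k :=
  MixedGraph path_arc_irr path_edge_irr path_edge_sym path_arc_asym
             path_arc_edge_excl.

End UndirectedPath.

Section Spectrum.
Variables (R : realType) (n : nat).

Definition adjacency_mx (G : mixed_graph n) : 'M[R]_n :=
  \matrix_(i, j) (out_adj G i j)%:R.

Definition out_degree_mx (G : mixed_graph n) : 'M[R]_n :=
  diag_mx (\row_i (out_degree G i)%:R).

Definition A_alpha (alpha : R) (G : mixed_graph n) : 'M[R]_n :=
  alpha *: out_degree_mx G + (1 - alpha) *: adjacency_mx G.

Definition is_largest_eigenvalue (M : 'M[R]_n) (r : R) : Prop :=
  eigenvalue M r /\ forall x : R, eigenvalue M x -> x <= r.

(* The default value 0 is used only if M has no real eigenvalue, which does
   not happen for the nonnegative matrices A_alpha with n > 0. *)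
Definition rho_alpha (alpha : R) (G : mixed_graph n) : R :=
  xget 0 (is_largest_eigenvalue (A_alpha alpha G)).

End Spectrum.

(* Main.v *)
(* A permutation contributing to the characteristic polynomial of A_alpha(T)
   has only fixed points and 2-cycles along undirected edges, because a longer
   cycle, or one through an arc, would be a cycle of the tree. The arcs may
   therefore be erased off the diagonal, which leaves a symmetric matrix S with
   the same eigenvalues, so that rho_alpha(T) is bounded below by the Rayleigh
   quotients of S.

   Deleting the arcs leaves at most 2n - m - 1 undirected components, so one of
   them has at least k vertices. Removing non-cut vertices one at a time, one
   enumerates k of its vertices as v_1, v_2, ... such that v_j is adjacent to
   some v_i with i <= max(1, j - 2). Let y_1 >= y_2 >= ... be the sorted
   absolute values of a top eigenvector of P_k. Among all arrangements of the
   y_j along a path, the form x^T A_alpha(P_k) x is largest for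
   ... y_5 y_3 y_1 y_2 y_4 ..., and putting y_j on v_j in T does at least as
   well, since the weight of an edge is monotone in the values at its ends. *)
Require Import Defs.
From mathcomp Require Import all_boot all_order all_algebra perm.
From mathcomp Require Import all_classical all_reals.
From mathcomp Require Import zify ring lra spectral sesquilinear complex.

Set Implicit Arguments.
Unset Strict Implicit.
Unset Printing Implicit Defensive.

Import Order.TTheory GRing.Theory Num.Theory.

Local Open Scope ring_scope.

(** * Rayleigh quotients of real symmetric matrices *)

(** Over the complex numbers [S] is unitarily diagonalisable with real spectrum. Were every
    eigenvalue below [lam], expanding [v] in the eigenbasis would put its Rayleigh quotient below
    [lam]. *)
Lemma symmetric_eigenvalue_ge (R : rcfType) n (S : 'M[R]_n) (v : 'rV[R]_n)
    (lam : R) :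
  S^T = S -> v != 0 -> lam * (v *m v^T) 0 0 <= (v *m S *m v^T) 0 0 ->
  exists2 mu, lam <= mu & eigenvalue S mu.
Proof.
move=> symS v0 le_lam.
pose toC := real_complex R.
have toC_conj x : Num.conj (toC x) = toC x by exact: conjc_real.
pose Sc := map_mx toC S; pose vc := map_mx toC v.
have hermS : Sc \is hermsymmx.
  apply/is_hermitianmxP; rewrite expr0 scale1r -map_trmx -map_mx_comp.
  by rewrite -{1}symS; apply/matrixP => i j; rewrite !mxE /= toC_conj.
have realD := hermitian_spectral_diag_real hermS.
have/hermitian_normalmx/orthomx_spectralP := hermS.
set P := spectralmx Sc; set D := spectral_diag Sc => defS.
have uP : P \is unitarymx by exact: spectral_unitarymx.
have unP : P \in unitmx by exact: spectral_unit.
have [j le_j] : exists j, toC lam <= D 0 j.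
  apply/existsP; rewrite -[X in is_true X]negbK negb_exists.
  apply/negP => /forallP ltD.
  have [w defv] : exists w, vc = w *m P.
    by exists (vc *m invmx P); rewrite mulmxKV.
  have vcT : (vc^T = vc^t*)%sesqui.
    by apply/matrixP => a b; rewrite !mxE /= toC_conj.
  have normv : toC ((v *m v^T) 0 0) = \sum_i w 0 i * (w 0 i)^*.
    have -> : toC ((v *m v^T) 0 0) = (vc *m vc^T) 0 0.
      by rewrite map_trmx -map_mxM [RHS]mxE.
    rewrite vcT defv trmx_mul map_mxM mulmxA mulmxtVK // mxE.
    by apply: eq_bigr => i _; rewrite !mxE.
  have quadv : toC ((v *m S *m v^T) 0 0) = \sum_i D 0 i * (w 0 i * (w 0 i)^*).
    have -> : toC ((v *m S *m v^T) 0 0) = (vc *m Sc *m vc^T) 0 0.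
      by rewrite map_trmx -!map_mxM [RHS]mxE.
    rewrite vcT {1}defv {1}defS !mulmxA mulmxK // defv trmx_mul map_mxM.
    rewrite mulmxA mulmxtVK // mxE.
    by apply: eq_bigr => i _; by rewrite mul_mx_diag !mxE mulrAC mulrC mulrA.
  have : \sum_i (toC lam - D 0 i) * (w 0 i * (w 0 i)^*) <= 0.
    under eq_bigr do rewrite mulrBl.
    rewrite sumrB -mulr_sumr -normv -quadv subr_le0 -rmorphM /=.
    by rewrite lecR.
  have pos i : 0 < toC lam - D 0 i.
    have := ltD i; rewrite -real_ltNge ?subr_gt0 //.
      by have /mxOverP := realD; apply.
    by apply/complex_realP; exists lam.
  have nn i : 0 <= (toC lam - D 0 i) * (w 0 i * (w 0 i)^*).
    by rewrite mulr_ge0 ?mul_conjC_ge0 // ltW.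
  move=> le0.
  have /eqP : \sum_i (toC lam - D 0 i) * (w 0 i * (w 0 i)^*) = 0.
    by apply/le_anti; rewrite le0 sumr_ge0.
  rewrite psumr_eq0 // => /allP w0.
  case/negP: v0; apply/eqP.
  have : vc = 0.
    rewrite defv (_ : w = 0) ?mul0mx //; apply/rowP => i.
    have := w0 i (mem_index_enum _).
    by rewrite mulf_eq0 gt_eqF //= mul_conjC_eq0 mxE => /eqP.
  by move/eqP; rewrite map_mx_eq0 => /eqP.
have /complex_realP[mu def_mu] : D 0 j \is Num.real.
  by have /mxOverP := realD; apply.
exists mu; first by move: le_j; rewrite def_mu lecR.
(* Row [j] of [P] is a complex eigenvector; since [mu] is real, it is also a root of the real
   characteristic polynomial. *)
have : eigenvalue Sc (toC mu).
  apply/eigenvalueP; exists (row j P).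
    rewrite {1}defS !mulmxA -row_mul mulmxV // row1.
    rewrite -mulmxA mul_diag_mx; apply/rowP => i.
    rewrite -rowE !mxE /= -[toC mu]def_mu //.
  apply/negP => /eqP rj0.
  have := congr1 (fun M => row j M) (mulmxV unP).
  rewrite row_mul rj0 mul0mx => /rowP/(_ j)/eqP.
  by rewrite !mxE eqxx eq_sym oner_eq0.
by rewrite !eigenvalue_root_char -map_char_poly fmorph_root.
Qed.

(** * Edge counts in acyclic graphs and vertex enumerations of connected ones *)

Section Combinatorics.
Local Open Scope nat_scope.
Variables (T : finType) (g : rel T).
Hypotheses (gsym : symmetric g) (girr : irreflexive g).

Definition pair_rel (s : seq (T * T)) : rel T :=
  [rel u v | ((u, v) \in s) || ((v, u) \in s)].

Lemma pair_rel_sym s : symmetric (pair_rel s).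
Proof. by move=> u v; apply: orbC. Qed.

(** Edges are added one at a time. The ends of a new edge carry different labels, since a path
    between them through earlier edges would close a cycle of [g]; merging their two classes costs
    one label. *)
Lemma forest_labelling (s : seq (T * T)) :
  (forall c, ucycle g c -> size c < 3) ->
  uniq s -> {in s, forall p, g p.1 p.2 && ((p.2, p.1) \notin s)} ->
  exists f : T -> T, #|codom f| + size s <= #|T| /\
    forall u v, f u = f v -> connect (pair_rel s) u v.
Proof.
move=> acyc; elim: s => [_ _ | [x y] s IHs /andP[xy_s uniq_s] gs].
  exists id; split=> [|u v ->]; last exact: connect0.
  by rewrite addn0 max_card.
have gs' : {in s, forall p, g p.1 p.2 && ((p.2, p.1) \notin s)}.
  move=> p ps; have /andP[-> ] := gs p (mem_behead (s := _ :: _) ps).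
  by rewrite inE negb_or => /andP[].
have [f [cardf connf]] := IHs uniq_s gs'.
have /andP[/= gxy yx_xys] := gs _ (mem_head _ _).
have yx_s : (y, x) \notin s.
  by apply: contra yx_xys => yx_s; rewrite in_cons yx_s orbT.
have step u v :
    connect (pair_rel s) u v -> connect (pair_rel ((x, y) :: s)) u v.
  apply: connect_sub => a b /= ab; apply/connect1 => /=.
  by rewrite /pair_rel /= !in_cons; case/orP: ab => ->; rewrite !orbT.
have fxy : f x != f y.
  apply/eqP => /connf/connectP[p0 + +]; case/shortenP => p path_p uniq_p _ def_y.
  have : size (x :: p) < 3.
    apply: acyc; rewrite /ucycle uniq_p andbT (cycle_path x) /= -def_y.
    rewrite gsym gxy /=; apply: sub_path path_p => a b /=.
    by case/orP => /gs' /andP[] //= + _; rewrite gsym.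
  (* Fewer than three vertices leave two cases: [x = y], or a path of one step, which would put the
     new pair or its reverse in [s]. *)
  case: p path_p def_y {uniq_p} => [_ /= def_y|z [|//]].
    by rewrite def_y girr in gxy.
  rewrite /= andbT => + def_y _; rewrite /= in def_y.
  by rewrite -def_y /pair_rel /= (negPf xy_s) (negPf yx_s).
exists (fun v => if f v == f x then f y else f v); split.
  rewrite addnS -addSn (leq_trans _ cardf) // ltn_add2r.
  rewrite [ltnRHS](cardD1 (f x)) codom_f ltnS; apply/subset_leq_card.
  apply/fintype.subsetP => _ /codomP[v ->]; rewrite !inE.
  by case: ifP => [_|->]; rewrite codom_f ?andbT // eq_sym.
have xy_conn : connect (pair_rel ((x, y) :: s)) x y.
  by apply/connect1; rewrite /pair_rel /= mem_head.
have csym := sym_connect_sym (pair_rel_sym ((x, y) :: s)).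
move=> u v; case: eqP => [/connf/step ux|_]; case: eqP => [/connf/step vx|_].
- by move=> _; apply: connect_trans ux _; rewrite csym.
- by move=> /connf/step yv; apply: connect_trans ux (connect_trans xy_conn yv).
- move=> /connf/step uy; apply: connect_trans uy _.
  by rewrite csym; apply: connect_trans vx xy_conn.
- by move=> /connf/step.
Qed.

(* Lists of vertices are built from right to left. *)
Fixpoint grown (s : seq T) : bool :=
  if s is v :: s' then nilp s' || (has (g v) s' && grown s') else false.

(* The neighbour of [v] must not be the vertex added just before [v], except
   for the second vertex. *)
Fixpoint spread (s : seq T) : bool :=
  match s with
  | [::] => false
  | [:: _] => true
  | [:: v; w] => g v w
  | v :: (_ :: s') as s1 => has (g v) s' && spread s1
  end.

(** The root of the growth is the last entry. To make the head [v] the root, the rest is rerooted at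
    a neighbour [y] of [v], and [v] is appended behind [y]. *)
Lemma grown_reroot s x : grown s -> x \in s ->
  exists2 t, perm_eq t s & grown t /\ last x t = x.
Proof.
elim: s x => // v s IHs x /=; case: s IHs => [_ _|w s IHs].
  by rewrite inE => /eqP->; exists [:: v].
set s1 := w :: s in IHs *; rewrite -/s1.
case/andP=> /hasP[y y_s gvy] gr; rewrite inE.
have [->|x_s] /= := eqVneq x v; last first.
  move=> /IHs[] // t pt [gt lt]; exists (v :: t); first by rewrite perm_cons.
  split; last by case: (t) (perm_size pt) lt.
  rewrite /= gt andbT; apply/orP; right.
  by apply/hasP; exists y; rewrite // (perm_mem pt).
move=> _; have [// | // | t pt [gt lt]] := IHs y.
exists (rcons t v); first by rewrite perm_rcons perm_cons.
rewrite last_rcons; split=> //; case/lastP: t gt lt {pt} => // t z.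
rewrite last_rcons => + zy; rewrite zy.
elim: t => [_|a t IHt] /=; first by rewrite gsym gvy.
have nn b : nilp (rcons t b) = false by case: (t).
have nn2 b c : nilp (rcons (rcons t b) c) = false by case: (t).
rewrite nn nn2 /= => /andP[h /IHt ->]; rewrite andbT.
by rewrite has_rcons h orbT.
Qed.

(* The head of the list is a non-cut vertex: it can be chosen different from
   the neighbour [u] of a vertex removed just before. *)
Lemma grown_spread s u : uniq s -> grown s -> u \in s ->
  exists2 t, perm_eq t s & spread t /\ (1 < size t -> head u t != u).
Proof.
have [n] := ubnP (size s); elim: n s u => // n IHn s0 u lt_n uniq_s gr u_s.
(* With [u] last, the head equals [u] only in a list of one entry. *)
have [s1 p1 [gr1 l1]] := grown_reroot gr u_s.
move: lt_n uniq_s; rewrite -(perm_size p1) -(perm_uniq p1) => lt_n uniq_s1.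
case: s1 => // v s in p1 gr1 l1 lt_n uniq_s1 *.
have [s_nil|s_nnil] := boolP (nilp s).
  exists (v :: s) => //; by rewrite (nilP s_nil).
move: gr1 uniq_s1; rewrite /= (negPf s_nnil) => /andP[/hasP[x x_s gvx] gr_s].
move=> /andP[v_s uniq_s].
(* Recursing with the neighbour [x] of [v] keeps [x] away from the head of [t], the position that
   [spread] does not accept. *)
have [t pt [spt hd]] := IHn s x lt_n uniq_s gr_s x_s.
exists (v :: t); first by rewrite -(permPr p1) perm_cons.
have x_t : x \in t by rewrite (perm_mem pt).
split; last first.
  move=> _ /=; apply: contraNneq v_s => ->; rewrite -l1.
  by case: (s) s_nnil => // a s' _; rewrite /= mem_last.
case: t hd spt x_t {pt} => [//|a [|b t]] /=.
  by rewrite inE => _ _ /eqP <-.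
move=> /(_ isT) ax spt; rewrite inE eq_sym (negPf ax) /= => x_t.
apply/andP; split=> //.
case/predU1P: x_t => [<-|x_t]; rewrite ?gvx //.
by apply/orP; right; apply/hasP; exists x.
Qed.

(** As long as the list is shorter than [C], some edge leaves it: otherwise it would be closed under
    [g] and contain all of [C]. The outer end of that edge extends the list. *)
Lemma connected_grown (C : {pred T}) x k :
  (forall y, y \in C -> connect g x y) -> 0 < k <= #|C| ->
  exists2 s, uniq s & [/\ grown s, size s = k & x \in s].
Proof.
move=> C_conn; elim: k => // -[_ _|k IHk /andP[_ lt_k]].
  by exists [:: x] => //; split; rewrite ?mem_head.
have [|s uniq_s [gr_s sz_s x_s]] := IHk; first exact: ltnW.
have [y yC y_s] : exists2 y, y \in C & y \notin s.
  apply/fintype.subsetPn; apply: contraL lt_k => /subset_leq_card.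
  by rewrite (card_uniqP uniq_s) sz_s -leqNgt.
have /existsP[a /existsP[b /and3P[gab a_s b_s]]] :
    [exists a, exists b, [&& g a b, a \in s & b \notin s]].
  apply: contraNT y_s => /existsPn no_out.
  rewrite -(closed_connect (a := mem s) _ (C_conn y yC)) //.
  apply: intro_closed; first exact: sym_connect_sym.
  move=> a b gab a_s; have /existsPn/(_ b) := no_out a.
  by rewrite gab a_s /= negbK.
exists (b :: s); first by rewrite /= b_s.
split; rewrite ?in_cons ?x_s ?orbT //=; last by rewrite sz_s.
by rewrite gr_s andbT; apply/orP; right; apply/hasP; exists a; rewrite // gsym.
Qed.

End Combinatorics.

(** * Rearrangement inequalities along cycles and paths *)

Section Rearrangement.
Variable R : realFieldType.
Implicit Types (f : R -> R -> R) (a b c x : R) (s l : seq R).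

Fixpoint pathsum f x s : R :=
  if s is y :: s' then f x y + pathsum f y s' else 0.

Definition cycsum f s : R :=
  if s is x :: s' then pathsum f x s' + f (last x s') x else 0.

(* The weight of the path  ... - 4 - 2 - 1 - 3 - 5 - ...  in which the entries
   of the list are numbered from right to left. *)
Fixpoint zigzag f s : R :=
  if s is a :: s1 then
    match s1 with
    | [::] => 0
    | [:: b] => f a b
    | _ :: c :: _ => f a c + zigzag f s1
    end
  else 0.

Lemma pathsum_cat f x s l :
  pathsum f x (s ++ l) = pathsum f x s + pathsum f (last x s) l.
Proof. by elim: s x => [|y s IHs] x /=; rewrite ?add0r // IHs addrA. Qed.

Lemma cycsum_rot f n s : cycsum f (rot n s) = cycsum f s.
Proof.
rewrite -[s in RHS](cat_take_drop n) /rot.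
case: (take n s) (drop n s) => [|x l] [|y s'] //=; rewrite ?cats0 //.
by rewrite !pathsum_cat !last_cat /=; ring.
Qed.

Lemma ends_ge_two_smallest a b l x s : sorted <=%R (a :: b :: l) ->
  perm_eq (x :: s) (a :: b :: l) ->
  (a <= x) && (b <= last x s) || (b <= x) && (a <= last x s).
Proof.
move=> /= /andP[ab /(order_path_min le_trans)/allP ble] p_xs.
have ge_a y : y \in x :: s -> a <= y.
  rewrite (perm_mem p_xs) !inE => /or3P[/eqP->|/eqP->|/ble] //.
  exact: le_trans.
have s_nnil : s <> [::] by move=> s0; have := perm_size p_xs; rewrite s0.
have last_s : last x s \in s.
  by case: (s) s_nnil => // z t _; exact: (mem_last z t).
rewrite !ge_a ?mem_head ?mem_last //= andbT.
have [xa|xa] := eqVneq x a.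
  move: p_xs last_s; rewrite xa perm_cons => /perm_mem -> .
  by rewrite inE => /predU1P[->|/ble->]; rewrite ?lexx.
apply/orP; right; have : x \in a :: b :: l by rewrite -(perm_mem p_xs) mem_head.
by rewrite !inE (negPf xa) /= => /predU1P[->|/ble].
Qed.

(** The zigzag path ends in [a] and [b], so the term [a * b] closes it into a cycle. The induction
    cuts the smallest entry [a] out of the cycle and joins its two neighbours. *)
Lemma cycsum_mul_le_zigzag a b l s :
  sorted <=%R (a :: b :: l) -> perm_eq s (a :: b :: l) ->
  cycsum *%R s <= a * b + zigzag *%R (a :: b :: l).
Proof.
elim: l a b s => [|c l IHl] a b s sorted_abl p_s.
  have := perm_size p_s; case: s p_s => [|x [|y []]] // p_s _.
  have := perm_big _ p_s : \prod_(i <- _) i = \prod_(i <- _) i.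
  by rewrite !big_cons big_nil !mulr1 /= addr0 [y * x]mulrC => ->.
have a_s : a \in s by rewrite (perm_mem p_s) mem_head.
have [i s' def_s] := rot_to a_s.
rewrite -(cycsum_rot _ i) def_s.
move: p_s; rewrite -(perm_rot i) def_s perm_cons => p_s'.
have sorted_bl : sorted <=%R (b :: c :: l) by case/andP: sorted_abl.
have := IHl b c s' sorted_bl p_s'.
case: s' p_s' {def_s} => [/perm_size //|h t] p_ht.
have /= := ends_ge_two_smallest sorted_bl p_ht.
have /and3P[ab bc _] := sorted_abl.
set u := last h t; set P := pathsum _ _ _; set Z := zigzag *%R (b :: c :: l).
rewrite -/Z -/P -/u => huv IH.
(* [h] and [u] are the neighbours of [a]. This is exactly what remains after the induction
   hypothesis, and it holds because [h] and [u] dominate [b] and [c] in some order. *)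
suff : 0 <= (h - a) * (u - a) - (b - a) * (c - a) by nra.
rewrite subr_ge0; case/orP: huv => /andP[h1 h2].
  by apply: ler_pM; lra.
by rewrite mulrC; apply: ler_pM; lra.
Qed.

(** The share of an undirected edge with end values [a] and [b] in the quadratic form of
    [A_alpha]. *)
Definition edge_form (al a b : R) :=
  al * (a ^+ 2 + b ^+ 2) + 2 * (1 - al) * (a * b).

(** Inner vertices of a path have degree 2 and its ends degree 1, so the diagonal part depends on
    the arrangement only through the ends. *)
Lemma pathsum_edge_form al x s :
  pathsum (edge_form al) x s =
    al * (2 * (\sum_(y <- x :: s) y ^+ 2) - x ^+ 2 - last x s ^+ 2)
    + 2 * (1 - al) * pathsum *%R x s.
Proof.
elim: s x => [|y s IHs] x /=; first by rewrite big_seq1; ring.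
by rewrite IHs !big_cons /edge_form; ring.
Qed.

Lemma zigzag_edge_form al a b l :
  zigzag (edge_form al) (a :: b :: l) =
    al * (2 * (\sum_(y <- a :: b :: l) y ^+ 2) - a ^+ 2 - b ^+ 2)
    + 2 * (1 - al) * zigzag *%R (a :: b :: l).
Proof.
elim: l a b => [|c l IHl] a b.
  by rewrite !big_cons big_nil /edge_form /=; ring.
rewrite -[LHS]/(edge_form al a c + zigzag (edge_form al) (b :: c :: l)).
rewrite -[zigzag _ [:: a, b, c & l]]/(a * c + zigzag *%R (b :: c :: l)).
by rewrite IHl !big_cons /edge_form; ring.
Qed.

(* Prepending 0 closes the path into a cycle. *)
Lemma pathsum_le_zigzag al x s l : 0 <= al <= 1 ->
  sorted <=%R l -> {in l, forall a, 0 <= a} -> perm_eq (x :: s) l ->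
  pathsum (edge_form al) x s <= zigzag (edge_form al) l.
Proof.
move=> /andP[al0 al1] sorted_l l0 p_xs.
case: l sorted_l l0 p_xs => [_ _ /perm_size //|a [|b l]] sorted_l l0 p_xs.
  by have /perm_size := p_xs; case: (s) => //.
rewrite pathsum_edge_form zigzag_edge_form (perm_big _ p_xs) /=.
have a0 : 0 <= a by rewrite l0 ?mem_head.
have b0 : 0 <= b by rewrite l0 // !inE eqxx orbT.
have sorted_0l : sorted <=%R (0 :: a :: b :: l) by rewrite /= a0.
have := cycsum_mul_le_zigzag sorted_0l (s := 0 :: x :: s).
rewrite perm_cons => /(_ p_xs).
rewrite -[zigzag _ _]/(0 * b + zigzag *%R (a :: b :: l)).
rewrite -[cycsum _ _]/(0 * x + pathsum *%R x s + last x s * 0).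
rewrite !mul0r mulr0 !add0r addr0 => le_prod.
apply: lerD; last by rewrite ler_wpM2l // mulr_ge0 // subr_ge0.
apply: ler_wpM2l => //.
(* The diagonal part loses the squares of the two ends; the loss is least when these are the two
   smallest entries. *)
have := ends_ge_two_smallest sorted_l p_xs.
set u := last x s; set S := \sum_(_ <- _) _.
by case/orP=> /andP[h1 h2]; nra.
Qed.

End Rearrangement.

(** * Quadratic forms of degree-plus-adjacency matrices *)

(** The share of one ordered adjacency: its out-degree term falls on the tail, whose value is
    [a]. *)
Definition arc_form (R : realFieldType) (al a b : R) : R :=
  al * a ^+ 2 + (1 - al) * (a * b).

Lemma arc_form_sym (R : realFieldType) (al a b : R) :
  arc_form al a b + arc_form al b a = edge_form al a b.
Proof. by rewrite /arc_form /edge_form; ring. Qed.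

Lemma arc_form_ge0 (R : realFieldType) (al a b : R) :
  0 <= al <= 1 -> 0 <= a -> 0 <= b -> 0 <= arc_form al a b.
Proof.
move=> /andP[al0 al1] a0 b0.
by rewrite addr_ge0 ?mulr_ge0 ?sqr_ge0 ?subr_ge0.
Qed.

(** The zigzag joins the head to the third entry. In a spread list the head has a neighbour at the
    third place or later, whose value is at least as large, and [edge_form] is monotone in
    nonnegative end values. *)
Lemma zigzag_le_spread (R : realFieldType) (al : R) (T : finType) (g : rel T)
    (u : T -> R) (s : seq T) :
  0 <= al <= 1 -> symmetric g -> (forall i, 0 <= u i) ->
  spread g s -> sorted <=%R (map u s) ->
  zigzag (edge_form al) (map u s) <=
    \sum_(i <- s) \sum_(j <- s) (g i j)%:R * arc_form al (u i) (u j).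
Proof.
move=> al01 gsym u0; have /andP[al0 al1] := al01.
have t0 i j : 0 <= (g i j)%:R * arc_form al (u i) (u j).
  by rewrite mulr_ge0 ?arc_form_ge0.
have step x s1 w : w \in s1 -> g x w ->
    edge_form al (u x) (u w)
    + \sum_(i <- s1) \sum_(j <- s1) (g i j)%:R * arc_form al (u i) (u j) <=
    \sum_(i <- x :: s1) \sum_(j <- x :: s1)
       (g i j)%:R * arc_form al (u i) (u j).
  move=> w_s1 gxw; rewrite big_cons.
  under [X in _ <= _ + X]eq_bigr do rewrite big_cons.
  rewrite big_split /= addrA lerD2r big_cons -addrA -arc_form_sym.
  apply: (le_trans _ (y := \sum_(j <- s1) (g x j)%:R * arc_form al (u x) (u j)
    + \sum_(j <- s1) (g j x)%:R * arc_form al (u j) (u x))); last first.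
    by rewrite lerDr.
  rewrite (big_rem w w_s1) (big_rem w w_s1 (F := fun j => (g j x)%:R * _)) /=.
  rewrite [g w x]gsym gxw !mul1r. rewrite [leRHS]addrACA lerDl.
  by rewrite addr_ge0 ?sumr_ge0.
elim: s => //= x s IHs; case: s IHs => [|w s] IHs.
  by move=> _ _; rewrite !sumr_ge0 // => i _; rewrite sumr_ge0.
case: s IHs => [|y s] IHs.
  move=> /= gxw _; apply: le_trans (step _ _ _ (mem_head _ _) gxw).
  by rewrite lerDl !sumr_ge0 // => i _; rewrite sumr_ge0.
rewrite -/(map u (y :: s)).
move=> /andP[/hasP[z z_s gxz] sp] /andP[_ sorted_s].
have z_ws : z \in w :: y :: s by rewrite in_cons z_s orbT.
apply: le_trans (step _ _ _ z_ws gxz).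
apply: lerD; last exact: IHs.
have yz : u y <= u z.
  move: z_s; rewrite inE => /predU1P[->//|z_s].
  have /andP[_ /(order_path_min le_trans)/allP le_y] := sorted_s.
  exact/le_y/map_f.
rewrite /edge_form; have := u0 x; have := u0 y; have := u0 z => z0 y0 x0.
apply: lerD; first by rewrite ler_wpM2l // lerD2l ler_sqr.
by rewrite ler_wpM2l ?mulr_ge0 ?subr_ge0 // ler_wpM2l.
Qed.

Lemma path_arc_form_sum (R : realFieldType) (al : R) (w : nat -> R) p :
  \sum_(i < p.+1) \sum_(j < p.+1)
     ((i.+1 == j) || (j.+1 == i))%:R * arc_form al (w i) (w j) =
  pathsum (edge_form al) (w 0%N) (map w (iota 1 p)).
Proof.
elim: p => [|p IHp].
  by rewrite !big_ord_recr !big_ord0 /= mul0r !add0r.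
have iota1S q : iota 1 q.+1 = iota 1 q ++ [:: q.+1]
  by rewrite -[q.+1 in LHS]addn1 iotaD.
rewrite iota1S map_cat pathsum_cat big_ord_recr /=.
under eq_bigr do rewrite big_ord_recr /=.
rewrite big_split /= IHp -addrA; congr (_ + _).
rewrite addr0 -arc_form_sym.
have -> : last (w 0%N) [seq w i | i <- iota 1 p] = w p.
  by case: p {IHp} => // p; rewrite iota1S map_cat last_cat.
have neq (i : 'I_p) : (i.+1 == p.+1) = false by rewrite eqSS ltn_eqF.
have neq2 (i : nat) : (i < p.+1)%N -> (p.+2 == i) = false.
  by move=> h; rewrite gtn_eqF // ltnS ltnW.
rewrite [\sum_(j < p.+2) _]big_ord_recr /=.
rewrite orbb gtn_eqF // mul0r addr0; congr (_ + _).
  rewrite big_ord_recr big1 /= ?eqxx ?add0r ?mul1r // => i _.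
  by rewrite neq neq2 ?mul0r // ltnW ?ltnS.
rewrite big_ord_recr big1 /= ?eqxx ?orbT ?add0r ?mul1r // => i _.
by rewrite neq neq2 ?mul0r // ltnW ?ltnS.
Qed.

Section AlphaMatrix.
Variables (R : realFieldType) (n : nat).
Implicit Types (al : R) (d : 'I_n -> nat) (g : rel 'I_n) (v : 'rV[R]_n).

(** The degrees [d] are independent of [g], so that the diagonal can keep the out-degrees of a mixed
    graph while its arcs are erased elsewhere. *)
Definition alpha_mx al d g : 'M[R]_n :=
  al *: diag_mx (\row_i (d i)%:R) + (1 - al) *: \matrix_(i, j) (g i j)%:R.

Lemma alpha_mx_quad al d g v :
  (v *m alpha_mx al d g *m v^T) 0 0 =
    al * (\sum_i (d i)%:R * v 0 i ^+ 2)
    + (1 - al) * (\sum_i \sum_j (g i j)%:R * (v 0 i * v 0 j)).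
Proof.
rewrite mulmxDr mulmxDl !mxE; congr (_ + _).
  rewrite mulr_sumr; apply: eq_bigr => i _.
  by rewrite -scalemxAr mul_mx_diag !mxE; ring.
rewrite exchange_big mulr_sumr; apply: eq_bigr => j _.
rewrite !mxE !mulr_suml mulr_sumr; apply: eq_bigr => i _.
by rewrite !mxE; ring.
Qed.

Lemma alpha_mx_quad_deg al g v :
  (v *m alpha_mx al (fun i => #|[pred j | g i j]|) g *m v^T) 0 0 =
    \sum_i \sum_j (g i j)%:R * arc_form al (v 0 i) (v 0 j).
Proof.
rewrite alpha_mx_quad !mulr_sumr -big_split; apply: eq_bigr => i _ /=.
rewrite -sum1_card natr_sum mulr_suml !mulr_sumr big_mkcond -big_split /=.
apply: eq_bigr => j _; rewrite inE /arc_form /=.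
by case: (g i j); rewrite ?mul0r ?mulr0 ?addr0 // !mul1r.
Qed.

Lemma alpha_mx_quad_le al d d' g v : 0 <= al -> (forall i, d i <= d' i)%N ->
  (v *m alpha_mx al d g *m v^T) 0 0 <= (v *m alpha_mx al d' g *m v^T) 0 0.
Proof.
move=> al0 le_d; rewrite !alpha_mx_quad lerD2r ler_wpM2l //.
by apply: ler_sum => i _; rewrite ler_wpM2r ?sqr_ge0 // ler_nat.
Qed.

Lemma tr_alpha_mx al d g : symmetric g -> (alpha_mx al d g)^T = alpha_mx al d g.
Proof.
move=> gsym; rewrite raddfD /= !linearZ /= tr_diag_mx; congr (_ + _ *: _).
by apply/matrixP => i j; rewrite !mxE gsym.
Qed.

End AlphaMatrix.

(** * Characteristic polynomial and largest eigenvalue *)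

Lemma char_poly_A_alpha (R : realType) (al : R) n (T : mixed_graph n) :
  (forall c : seq 'I_n, ucycle (underlying T) c -> (size c < 3)%N) ->
  char_poly (A_alpha al T) =
    char_poly (alpha_mx al (out_degree T) (und_edge T)).
Proof.
move=> acyc; rewrite /char_poly /determinant; apply: eq_bigr => s _.
congr (_ * _).
have [/existsP[i arc_i]|/existsPn no_arc] := boolP [exists i, dir_arc T i (s i)];
  last first.
  apply: eq_bigr => i _; rewrite !mxE.
  by rewrite /out_adj /= (negPf (no_arc i)).
have nadj a b : a != b -> ~~ out_adj T a b ->
    char_poly_mx (A_alpha al T) a b = 0.
  move=> ab; rewrite !mxE (negPf ab) => /negPf /= ->.
  by rewrite mulr0n !mulr0 addr0 oppr0 add0r.
have nund a b : a != b -> ~~ und_edge T a b ->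
    char_poly_mx (alpha_mx al (out_degree T) (und_edge T)) a b = 0.
  move=> ab; rewrite !mxE (negPf ab) => /negPf /= ->.
  by rewrite mulr0n !mulr0 addr0 oppr0 add0r.
have i_si : i != s i by apply: contraTneq arc_i => <-; rewrite dir_arc_irr.
rewrite [RHS](bigD1 i) //= nund ?mul0r //; last exact: arc_edge_excl.
(* Either some moved vertex has no adjacency along [s] and the left product vanishes too, or the
   orbit of [i] is a cycle of the underlying graph. *)
have [/existsP[j /andP[j_sj nj]]|/existsPn adj] :=
  boolP [exists j, (j != s j) && ~~ out_adj T j (s j)].
  by rewrite (bigD1 j) //= nadj ?mul0r.
exfalso.
have moved j : j \in orbit s i -> j != s j.
  rewrite -fconnect_orbit => /iter_findex <-.
  elim: (findex _ _ _) => //= m; apply: contra_neq => /perm_inj //.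
have out j : j != s j -> out_adj T j (s j).
  by move=> j_sj; have := adj j; rewrite j_sj negbK.
have cyc : ucycle (underlying T) (orbit s i).
  rewrite /ucycle orbit_uniq andbT.
  have /= := cycle_orbit (@perm_inj _ s) i.
  apply: sub_in_cycle; last by apply/allP => j ji; exact: ji.
  move=> a b /moved/out + _ /eqP <-; rewrite /underlying /=.
  by case/orP => ->; rewrite ?orbT.
have := acyc _ cyc; rewrite size_orbit => lt3.
(* The orbit of the moved vertex [i] has exactly two elements, so [s i] is out-adjacent to [i],
   which the arc from [i] to [s i] excludes. *)
have ss : s (s i) = i.
  have := iter_order (@perm_inj _ s) i.
  move: lt3; case: order (order_gt0 s i) => [//|[|[|//]]] _ _ /= e //.
  by rewrite e eqxx in i_si.
have := out (s i); rewrite ss eq_sym => /(_ i_si) /orP[].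
  by apply/negP; exact: dir_arc_asym.
by rewrite und_edge_sym; apply/negP; exact: arc_edge_excl.
Qed.

Lemma largest_root (R : realDomainType) (p : {poly R}) x :
  p != 0 -> root p x -> exists2 r, root p r & forall y, root p y -> y <= r.
Proof.
have [m] := ubnP (size p); elim: m p x => // m IHm p x sz_p p0 px.
have /factor_theorem[q def_p] := px.
have q0 : q != 0 by apply: contraNneq p0 => q0; rewrite def_p q0 mul0r.
have root_p y : root p y = root q y || (y == x).
  by rewrite def_p rootM root_XsubC.
have [[y qy]|no_root] := EM (exists y, root q y); last first.
  exists x => // y; rewrite root_p => /orP[qy|/eqP->//].
  by case: no_root; exists y.
have [|r qr max_r] := IHm q y _ q0 qy.
  by move: sz_p; rewrite def_p size_Mmonic ?monicXsubC // size_XsubC addn2.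
exists (Num.max r x).
  by rewrite root_p maxEle; case: ifP; rewrite ?eqxx ?orbT ?qr.
by move=> z; rewrite root_p le_max => /orP[/max_r->|/eqP->]; rewrite ?lexx ?orbT.
Qed.

(** The characteristic polynomial is nonzero, so a single real eigenvalue already ensures a largest
    one, and [xget] does not fall back on 0. *)
Lemma rho_alpha_largest (R : realType) (al mu : R) n (G : mixed_graph n) :
  eigenvalue (A_alpha al G) mu ->
  is_largest_eigenvalue (A_alpha al G) (rho_alpha al G).
Proof.
rewrite eigenvalue_root_char => root_mu.
have [r root_r max_r] := largest_root (monic_neq0 (char_poly_monic _)) root_mu.
apply: xgetPex; exists r; split; first by rewrite eigenvalue_root_char.
by move=> x; rewrite eigenvalue_root_char; apply: max_r.
Qed.

(** * Comparison of largest eigenvalues by a test vector *)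

(** Passing to absolute values keeps the squares and can only increase the products. *)
Lemma undirected_path_form (R : realType) (al : R) p (v : 'rV[R]_p.+1) :
  0 <= al <= 1 ->
  (v *m A_alpha al (undirected_path p.+1) *m v^T) 0 0 <=
  pathsum (edge_form al) `|v 0 ord0| [seq `|v 0 (inord i)| | i <- iota 1 p].
Proof.
move=> /andP[al0 al1].
have -> : `|v 0 ord0| = `|v 0 (inord 0)|.
  by congr `|v 0 _|; apply: val_inj; rewrite /= inordK.
rewrite -(path_arc_form_sum al (fun i => `|v 0 (inord i)|)).
rewrite [leLHS](_ : _ = \sum_i \sum_j
  (path_edge i j)%:R * arc_form al (v 0 i) (v 0 j)); last first.
  exact: alpha_mx_quad_deg.
apply: ler_sum => i _; apply: ler_sum => j _; rewrite !inord_val.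
rewrite ler_wpM2l // /arc_form real_normK ?num_real // lerD2l.
by rewrite ler_wpM2l ?subr_ge0 // -normrM ler_norm.
Qed.

Lemma rho_path_le_spread (R : realType) (al : R) n (T : mixed_graph n)
    (s : seq 'I_n) :
  0 <= al <= 1 ->
  (forall c : seq 'I_n, ucycle (underlying T) c -> (size c < 3)%N) ->
  uniq s -> spread (und_edge T) s ->
  rho_alpha al (undirected_path (size s)) <= rho_alpha al T.
Proof.
move=> al01 acyc uniq_s spread_s.
have [p def_p] : exists p, size s = p.+1.
  by case: (s) spread_s => // x t _; exists (size t).
rewrite def_p; set P := undirected_path p.+1.
(* The all-ones vector with its own Rayleigh quotient yields some real eigenvalue of the path. *)
have [mu eig_mu] : exists mu, eigenvalue (A_alpha al P) mu.
  have v0 : (const_mx 1 : 'rV[R]_p.+1) != 0.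
    by apply/eqP => /rowP/(_ ord0)/eqP; rewrite !mxE oner_eq0.
  have symP : (A_alpha al P)^T = A_alpha al P.
    exact/tr_alpha_mx/path_edge_sym.
  set v := const_mx 1 in v0.
  have vv : (v *m v^T) 0 0 != 0.
    rewrite mxE; under eq_bigr do rewrite !mxE mulr1.
    by rewrite sumr_const card_ord pnatr_eq0.
  have [|mu _ eig] := symmetric_eigenvalue_ge symP v0
    (lam := (v *m A_alpha al P *m v^T) 0 0 / (v *m v^T) 0 0).
    by rewrite divfK.
  by exists mu.
have [/eigenvalueP[v eig_v v0] _] := rho_alpha_largest eig_mu.
set lam := rho_alpha al P in eig_v *.
pose w := [seq `|v 0 i| | i <- enum 'I_p.+1].
have def_w : w = `|v 0 ord0| :: [seq `|v 0 (inord i)| | i <- iota 1 p].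
  rewrite /w -[RHS]/(`|v 0 ord0| :: _).
  rewrite -[X in X :: _](_ : `|v 0 (inord 0)| = _); last first.
    by congr `|v 0 _|; apply: val_inj; rewrite /= inordK.
  rewrite -[RHS]/[seq `|v 0 (inord i)| | i <- iota 0 p.+1].
  rewrite -val_enum_ord -map_comp.
  by apply: eq_map => i /=; rewrite inord_val.
pose y := sort <=%R w.
have perm_y : perm_eq w y by rewrite perm_sym perm_sort.
have sorted_y : sorted <=%R y by apply: sort_le_sorted.
have sz_y : size y = size s by rewrite size_sort size_map size_enum_ord def_p.
have y0 : {in y, forall a, 0 <= a}.
  by move=> a; rewrite -(perm_mem perm_y) => /mapP[i _ ->].
(* Outside [s] the index is [size s], which is also the size of [y], so the default value extends
   the vector by zero. *)
pose u i := nth 0 y (index i s).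
have map_u : map u s = y.
  apply: (@eq_from_nth _ 0); rewrite size_map // => i lt_i.
  have x0 : 'I_n by case: (s) lt_i.
  by rewrite (nth_map x0) // /u index_uniq.
have u0 i : 0 <= u i.
  rewrite /u; have [lt_i|ge_i] := ltnP (index i s) (size y).
    by rewrite y0 ?mem_nth.
  by rewrite nth_default.
pose x := \row_i u i.
have norm_vv : (v *m v^T) 0 0 = \sum_(a <- w) a ^+ 2.
  rewrite mxE big_map big_enum /=; apply: eq_bigr => i _.
  by rewrite mxE real_normK ?num_real // expr2.
have norm_xx : (x *m x^T) 0 0 = (v *m v^T) 0 0.
  rewrite norm_vv (perm_big _ perm_y) /= -map_u big_map mxE.
  rewrite (bigID (mem s)) /= addrC big1 => [|i i_s]; last first.
    by rewrite !mxE /u nth_default ?mulr0 // memNindex ?sz_y.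
  rewrite add0r -big_uniq //=; apply: eq_bigr => i _.
  by rewrite !mxE expr2.
have vv_gt0 : 0 < (v *m v^T) 0 0.
  rewrite norm_vv big_map big_enum /= lt_neqAle sumr_ge0 => [|i _]; last first.
    exact: sqr_ge0.
  rewrite andbT eq_sym psumr_eq0 => [|i _]; last exact: sqr_ge0.
  apply: contra v0 => /allP v0; apply/eqP/rowP => i.
  by have := v0 i (mem_index_enum _); rewrite sqrf_eq0 normr_eq0 mxE => /eqP.
have x0 : x != 0.
  by apply: contraTneq vv_gt0 => x0; rewrite -norm_xx x0 mul0mx mxE ltxx.
pose S := alpha_mx al (out_degree T) (und_edge T).
have symS : S^T = S by apply/tr_alpha_mx/und_edge_sym.
have le_lam : lam * (x *m x^T) 0 0 <= (x *m S *m x^T) 0 0.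
  rewrite norm_xx.
  have -> : lam * (v *m v^T) 0 0 = (v *m A_alpha al P *m v^T) 0 0.
    by rewrite eig_v -scalemxAl [RHS]mxE.
  apply: le_trans (undirected_path_form _ al01) _.
  have perm_wy := perm_y; rewrite def_w in perm_wy.
  apply: le_trans (pathsum_le_zigzag al01 sorted_y y0 perm_wy) _.
  have /andP[al0 al1] := al01.
  (* Out-degrees count arcs as well as edges, so the diagonal of [S] dominates that of the
     undirected part. *)
  have le_deg i : (#|[pred j | und_edge T i j]| <= out_degree T i)%N.
    apply/subset_leq_card/fintype.subsetP => j.
    by rewrite !inE /out_adj /= => ->; rewrite orbT.
  apply: le_trans (alpha_mx_quad_le _ _ al0 le_deg).
  rewrite alpha_mx_quad_deg -map_u.
  apply: le_trans (zigzag_le_spread al01 (@und_edge_sym _ T) u0 spread_s _) _.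
    by rewrite map_u.
  have t0 i j : 0 <= (und_edge T i j)%:R * arc_form al (u i) (u j).
    by rewrite mulr_ge0 ?arc_form_ge0.
  under [leRHS]eq_bigr do under eq_bigr do rewrite !mxE.
  rewrite [leRHS](bigID (mem s)) /= -big_uniq //= ler_wpDr ?sumr_ge0 //.
    by move=> i _; rewrite sumr_ge0.
  apply: ler_sum => i _.
  by rewrite [leRHS](bigID (mem s)) /= -big_uniq //= ler_wpDr ?sumr_ge0.
have [nu le_nu eig_nu] := symmetric_eigenvalue_ge symS x0 le_lam.
have eig_T : eigenvalue (A_alpha al T) nu.
  by rewrite eigenvalue_root_char char_poly_A_alpha // -eigenvalue_root_char.
have [_ max_T] := rho_alpha_largest eig_T.
exact: le_trans le_nu (max_T _ eig_T).
Qed.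

(** * Edges and undirected components of a mixed tree *)

Section Counting.
Local Open Scope nat_scope.
Variables (n : nat) (T : mixed_graph n).
Hypothesis treeT : is_mixed_tree T.

Let arcs := #|[pred p : 'I_n * 'I_n | dir_arc T p.1 p.2]|.
Let edges := #|[pred p : 'I_n * 'I_n | (p.1 < p.2) && und_edge T p.1 p.2]|.

Lemma underlying_sym : symmetric (underlying T).
Proof. by move=> i j; rewrite /underlying /= orbCA und_edge_sym. Qed.

Lemma underlying_irr : irreflexive (underlying T).
Proof. by move=> i; rewrite /underlying /= dir_arc_irr und_edge_irr. Qed.

(** Each arc and each edge is listed once as a pair; at least one label is left over. *)
Lemma tree_size_lt : arcs + edges < n.
Proof.
have [n0 _ acyc] := treeT.
pose A := [pred p : 'I_n * 'I_n |
  dir_arc T p.1 p.2 || (p.1 < p.2) && und_edge T p.1 p.2].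
have [|f [card_f _]] := forest_labelling underlying_sym underlying_irr
  acyc (enum_uniq A).
  move=> [i j]; rewrite mem_enum inE /= /underlying /= mem_enum inE /= => ij.
  apply/andP; split; first by case/orP: ij => [->|/andP[_ ->]]; rewrite ?orbT.
  case/orP: ij => [ij|/andP[lt_ij ij]].
    by rewrite negb_or dir_arc_asym // und_edge_sym negb_and arc_edge_excl ?orbT.
  rewrite negb_or ltnNge (ltnW lt_ij) andbT.
  by apply: contraTN ij => /arc_edge_excl; rewrite und_edge_sym.
rewrite -cardE card_ord in card_f; apply: leq_trans card_f.
rewrite -[_.+1]add1n leq_add //.
  by apply/card_gt0P; exists (f (Ordinal n0)); apply: codom_f.
rewrite -cardUI [X in _ + X](_ : _ = 0) ?addn0.
  by rewrite (@eq_card _ _ A).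
apply: eq_card0 => p; rewrite !inE; apply/negP => /and3P[ar _ ed].
by have := arc_edge_excl ar; rewrite ed.
Qed.

(** Labelling along the undirected edges uses at most [n - edges] labels, and each label class lies
    within one component, hence is no larger than the largest one. *)
Lemma large_component : exists x,
  n <= #|[pred y | connect (und_edge T) x y]| * (n - edges).
Proof.
have [n0 _ acyc] := treeT.
pose A := [pred p : 'I_n * 'I_n | (p.1 < p.2) && und_edge T p.1 p.2].
have acyc_und (c : seq 'I_n) : ucycle (und_edge T) c -> size c < 3.
  move=> /andP[cyc uniq_c]; apply: acyc; rewrite /ucycle uniq_c andbT.
  by apply: sub_cycle cyc => i j /= ij; rewrite /underlying /= ij !orbT.
have [|f [card_f conn_f]] := forest_labelling (@und_edge_sym _ T)
  (@und_edge_irr _ T) acyc_und (enum_uniq A).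
  move=> [i j]; rewrite mem_enum inE /= => /andP[lt_ij ->] /=.
  by rewrite mem_enum inE /= ltnNge (ltnW lt_ij).
rewrite -cardE card_ord in card_f.
have {}conn_f u v : f u = f v -> connect (und_edge T) u v.
  move=> /conn_f; apply: connect_sub => i j.
  rewrite /pair_rel /= !mem_enum !inE /= => ij; apply: connect1.
  by case/orP: ij => /andP[_ //]; rewrite und_edge_sym.
pose i0 := Ordinal n0.
pose comp x := #|[pred y | connect (und_edge T) x y]|.
case: (@arg_maxnP _ i0 predT comp isT) => x _ max_x; exists x.
rewrite -[leqLHS]card_ord -sum1_card (partition_big f (mem (codom f))) /=;
  last by move=> v _; apply: codom_f.
apply: (@leq_trans (\sum_(y in codom f) comp x)).
  apply: leq_sum => _ /codomP[u ->]; rewrite sum1_card.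
  apply: leq_trans (max_x u isT).
  apply/subset_leq_card/fintype.subsetP => v; rewrite !inE => /eqP fvu.
  exact/conn_f/esym/val_inj.
rewrite sum_nat_const mulnC leq_mul2l; apply/orP; right.
by rewrite -(leq_add2r edges) subnK // (leq_trans _ card_f) ?leq_addl.
Qed.

End Counting.

(** * The path case, invariance under isomorphism, and the bound *)

Lemma path_iso_edges n (T : mixed_graph n) :
  mixed_iso T (undirected_path n) ->
  (n <= #|[pred p : 'I_n * 'I_n | (p.1 < p.2)%N && und_edge T p.1 p.2]|.+1)%N.
Proof.
case: n T => // p G [s iso_s].
pose h (i : 'I_p) : 'I_p.+1 * 'I_p.+1 :=
  let a := (s^-1)%g (widen_ord (leqnSn p) i) in
  let b := (s^-1)%g (lift ord0 i) in
  (* Each of the [p] path edges is pulled back and ordered in the way edges are counted. *)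
  if (a < b)%N then (a, b) else (b, a).
rewrite ltnS -[leqLHS]card_ord -(@card_codom _ _ h).
  apply/subset_leq_card/fintype.subsetP => _ /codomP[i ->].
  rewrite inE /h; set a := (s^-1)%g _; set b := (s^-1)%g _.
  have und_ab : und_edge G a b.
    have [_ <-] := iso_s a b; rewrite /a /b !permKV.
    by apply/orP; left; exact: eqxx.
  have ab : (a != b :> nat).
    by apply: contraTneq und_ab => /val_inj->; rewrite und_edge_irr.
  by case: (ltngtP a b) ab => //= ab _; rewrite ab //= und_edge_sym.
move=> i j; rewrite /h.
have inj u v : (s^-1)%g u = (s^-1)%g v -> u = v :> nat by move=> /perm_inj ->.
case: ifP => _; case: ifP => _ [/inj /= h1 /inj /= h2]; apply: val_inj;
  rewrite /= /bump /= in h1 h2 *; lia.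
Qed.

Lemma rho_alpha_iso (R : realType) (al : R) n (G H : mixed_graph n) :
  mixed_iso G H -> rho_alpha al G = rho_alpha al H.
Proof.
move=> [s iso_s].
have adj i j : out_adj H (s i) (s j) = out_adj G i j.
  by rewrite /out_adj /=; have [-> ->] := iso_s i j.
have deg i : out_degree H (s i) = out_degree G i.
  rewrite /out_degree -!sum1_card (reindex_inj (@perm_inj _ s)) /=.
  by apply: eq_bigl => j; rewrite !inE adj.
have entry i j : A_alpha al H (s i) (s j) = A_alpha al G i j.
  by rewrite !mxE adj deg (inj_eq perm_inj).
rewrite /rho_alpha; congr (xget 0 _); apply: funext => r; apply: propext.
suff eig x : eigenvalue (A_alpha al G) x = eigenvalue (A_alpha al H) x.
  by rewrite /is_largest_eigenvalue eig; split=> -[? h]; split=> // x;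
    [rewrite -eig | rewrite eig]; apply: h.
apply/idP/idP => /eigenvalueP[v eig_v v0]; apply/eigenvalueP.
  exists (\row_i v 0 ((s^-1)%g i)).
    apply/rowP => j; rewrite !mxE.
    have /rowP/(_ ((s^-1)%g j)) := eig_v; rewrite !mxE => <-.
    rewrite (reindex_inj (@perm_inj _ s)) /=; apply: eq_bigr => i _.
    by rewrite mxE permK -entry permKV.
  apply: contra_neq v0 => /rowP v0; apply/rowP => i.
  by have := v0 (s i); rewrite !mxE permK.
exists (\row_i v 0 (s i)).
  apply/rowP => j; rewrite !mxE.
  have /rowP/(_ (s j)) := eig_v; rewrite !mxE => <-.
  rewrite [RHS](reindex_inj (@perm_inj _ s)) /=; apply: eq_bigr => i _.
  by rewrite mxE entry.
apply: contra_neq v0 => /rowP v0; apply/rowP => i.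
by have := v0 ((s^-1)%g i); rewrite !mxE permKV.
Qed.

Theorem theorem1p2 (R : realType) (alpha : R) (halpha : 0 <= alpha <= 1)
    (n m : nat) (T : mixed_graph n) (hT : is_mixed_tree T)
    (hm : mixed_size T = m) (k : nat)
    (hk : k%:Z = Num.ceil (n%:R / (2 * n%:R - m%:R - 1) : rat)) :
  rho_alpha alpha (undirected_path k) <= rho_alpha alpha T
  /\ (mixed_iso T (undirected_path n) ->
      rho_alpha alpha T = rho_alpha alpha (undirected_path k)).
Proof.
have [n0 _ acyc] := hT.
have lt_n := tree_size_lt hT; have [x large_x] := large_component hT.
have iso_edges := @path_iso_edges n T.
move: hm; rewrite /mixed_size.
set arcs := #|_| in lt_n *; set edges := #|_| in lt_n large_x iso_edges *.
move=> def_m.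
(* The subtraction does not truncate: [m] is at most [2 * (arcs + edges)], hence at most
   [2 * n - 2]. *)
pose q := (2 * n - m - 1)%N.
have q0 : (0 < q)%N by rewrite /q; lia.
have def_q : 2 * n%:R - m%:R - 1 = q%:R :> rat.
  by rewrite /q -[1]/(1%:R) -natrM !natrB //; lia.
rewrite {}def_q in hk.
have k0 : (0 < k)%N.
  by rewrite -ltz_nat hk ceil_gt0 divr_gt0 ?ltr0n.
(* The ceiling makes [k] the least integer with [n <= k * q]. *)
have le_k c : (n <= c * q)%N -> (k <= c)%N.
  move=> le_n; rewrite -lez_nat hk ceil_le_int -pmulrn ler_pdivrMr ?ltr0n //.
  by rewrite -natrM ler_nat.
split=> [|iso_T]; last first.
  rewrite (rho_alpha_iso _ iso_T); suff -> : k = n by [].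
  (* At least [n - 1] edges force [arcs = 0] and [m = 2 * n - 2]. *)
  have q1 : q = 1%N by have := iso_edges iso_T; rewrite /q; lia.
  by apply/eqP; rewrite -eqz_nat hk q1 divr1 pmulrn intrKceil.
have [s uniq_s [grown_s sz_s x_s]] : exists2 s, uniq s &
    [/\ grown (und_edge T) s, size s = k & x \in s].
  apply: (connected_grown (@und_edge_sym _ T)
    (C := [pred y | connect (und_edge T) x y])) => // ; rewrite k0 le_k //.
  (* [n - edges <= q] is a restatement of [arcs + edges < n]. *)
  by apply: leq_trans large_x _; rewrite leq_mul2l /q; apply/orP; right; lia.
have [t perm_t [spread_t _]] :=
  grown_spread (@und_edge_sym _ T) uniq_s grown_s x_s.
rewrite -sz_s -(perm_size perm_t).
by apply: rho_path_le_spread; rewrite ?(perm_uniq perm_t).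
Qed.
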